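(* Let $\mathit{init}$, $\mathit{env}$, $\mathit{ctrl}$, $\mathit{plant}$, $\mathit{guarantee}$ be given, over the real-valued variables $x, v, x_c, v_c, a_n, a_s, \tau$ and the real symbolic parameters $a_s^{\min}, a_n^{\min}, a_n^{\max}, T$ (never modified by the programs), by $$\mathit{guarantee} \equiv (x \ge x_c \to v \le v_c),$$ $$\mathit{plant} \equiv \tau := 0;\ \{x' = v,\ v' = a_s,\ \tau' = 1\ \&\ v \ge 0 \land \tau \le T\},$$ $$\mathit{ctrl} \equiv \text{if } (x_c - x \ge \mathrm{msd}(T))\ \ a_s := a_n\ \ \text{else}\ \ a_s := -a_s^{\min},$$ $$\mathrm{msd}(t) \equiv vt + \frac{a_n^{\max} t^2}{2} + \frac{(v + a_n^{\max} t)^2 - v_c^2}{2 a_s^{\min}},$$ $$\mathit{env} \equiv x_c := *;\ v_c := *;\ ?(v_c \ge 0 \land x_c - x \ge \mathrm{msd}(0));\ a_n := *;\ ?(-a_n^{\min} \le a_n \le a_n^{\max}),$$ $$\mathit{init} \equiv a_s^{\min} > 0 \land a_n^{\max} > 0 \land a_n^{\min} > 0 \land T > 0 \land v \ge 0 \land v_c \ge 0 \land x_c - x \ge \mathrm{msd}(0).$$ Then the differential dynamic logic formula $$\mathit{init} \to [(\mathit{env};\ \mathit{ctrl};\ \mathit{plant})^*]\,\mathit{guarantee}$$ is valid; that is, for every state satisfying $\mathit{init}$, every state reachable from it by executing the hybrid program $(\mathit{env};\mathit{ctrl};\mathit{plant})^*$ satisfies $\mathit{guarantee}$.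
   Context: Interpretation: a vehicle has position $x$ and velocity $v$; $x_c$ and $v_c$ are a critical position and critical velocity supplied by the environment; $a_n$ is the nominal requested acceleration; $a_s$ is the acceleration issued by the safety controller; $T$ is the maximal sampling time; $a_n^{\min}, a_n^{\max}, a_s^{\min}$ are positive acceleration/braking bounds. Hybrid programs and semantics. A state is a map from variables to $\mathbb{R}$. Each hybrid program $\alpha$ denotes a reachability relation $\rho(\alpha)$ on states: - $y := e$: the value of $y$ becomes the current value of the term $e$, all other variables unchanged. - $y := *$: the value of $y$ becomes an arbitrary real number, all other variables unchanged. - $?P$: relates a state to itself if $P$ holds there; otherwise the run aborts (no successor state). - $\{y' = f(y)\ \&\ Q\}$: relates $s$ to $s'$ if for some duration $d \ge 0$ there is a solution of the differential equation system on $[0,d]$ starting at $s$, ending at $s'$, such that $Q$ holds at all times in $[0,d]$; variables not in the system are unchanged. - $\alpha;\beta$: sequential composition. $\alpha \cup \beta$: nondeterministic choice (union of relations). - $\text{if }(P)\ \alpha\ \text{else}\ \beta$ abbreviates $(?P;\alpha)\cup(?\neg P;\beta)$. - $\alpha^*$: $\alpha$ repeated any finite number $n \ge 0$ of times (reflexive transitive closure). The formula $[\alpha]\phi$ holds in $s$ iff $\phi$ holds in every $s'$ with $(s,s')\in\rho(\alpha)$. A formula is valid if it holds in all states. The expression $\mathrm{msd}(t)$ is always evaluated with the current values of the variables occurring in it. *)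

(* Defs.v *)
From Stdlib Require Import Reals List Relation_Operators.
Open Scope R_scope.

(** * Differential dynamic logic *)

(** The symbolic parameters are variables of the state as well; they stay
    constant because no program assigns to them. *)
Inductive var : Set :=
  | x | v | x_c | v_c | a_n | a_s | tau
  | a_s_min | a_n_min | a_n_max | T.

Definition var_eq_dec (y z : var) : {y = z} + {y <> z}.
Proof. decide equality. Defined.

Definition state : Type := var -> R.

Definition update (s : state) (y : var) (r : R) : state :=
  fun z => if var_eq_dec z y then r else s z.

Inductive term : Type :=
  | Var (y : var)
  | Const (r : R)
  | Opp (e : term)
  | Add (e1 e2 : term)
  | Sub (e1 e2 : term)
  | Mul (e1 e2 : term)
  | Div (e1 e2 : term)
  | Pow (e : term) (n : nat).

Inductive formula : Type :=
  | Le (e1 e2 : term)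
  | Lt (e1 e2 : term)
  | Not (P : formula)
  | And (P Q : formula)
  | Imp (P Q : formula)
  | Box (a : program) (P : formula)
with program : Type :=
  | Assign (y : var) (e : term)
  | AssignAny (y : var)
  | Test (P : formula)
  | ODE (sys : list (var * term)) (Q : formula)
  | Seq (a b : program)
  | Choice (a b : program)
  | Star (a : program).

Definition If (P : formula) (a b : program) : program :=
  Choice (Seq (Test P) a) (Seq (Test (Not P)) b).

Fixpoint eval (s : state) (e : term) : R :=
  match e with
  | Var y => s y
  | Const r => r
  | Opp e => - eval s e
  | Add e1 e2 => eval s e1 + eval s e2
  | Sub e1 e2 => eval s e1 - eval s e2
  | Mul e1 e2 => eval s e1 * eval s e2
  | Div e1 e2 => eval s e1 / eval s e2
  | Pow e n => eval s e ^ n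
  end.

(** [D_in] is differentiability relative to [[0, d]], so the derivative is
    one-sided at the two end points, and unconstrained when [d = 0].  *)
Definition solves (sys : list (var * term)) (d : R) (phi : R -> state) : Prop :=
  (forall y e, In (y, e) sys ->
     forall t, 0 <= t <= d ->
       D_in (fun u => phi u y) (fun u => eval (phi u) e)
            (fun u => 0 <= u <= d) t) /\
  (forall y, ~ In y (map fst sys) ->
     forall t, 0 <= t <= d -> phi t y = phi 0 y).

Fixpoint holds (P : formula) (s : state) : Prop :=
  match P with
  | Le e1 e2 => eval s e1 <= eval s e2
  | Lt e1 e2 => eval s e1 < eval s e2
  | Not P => ~ holds P s
  | And P Q => holds P s /\ holds Q s
  | Imp P Q => holds P s -> holds Q s
  | Box a P => forall s', reach a s s' -> holds P s'
  end
with reach (a : program) (s s' : state) : Prop :=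
  match a with
  | Assign y e => s' = update s y (eval s e)
  | AssignAny y => exists r : R, s' = update s y r
  | Test P => s' = s /\ holds P s
  | ODE sys Q =>
      exists (d : R) (phi : R -> state),
        0 <= d /\ phi 0 = s /\ phi d = s' /\ solves sys d phi /\
        (forall t, 0 <= t <= d -> holds Q (phi t))
  | Seq a b => exists s0, reach a s s0 /\ reach b s0 s'
  | Choice a b => reach a s s' \/ reach b s s'
  | Star a => clos_refl_trans state (reach a) s s'
  end.

Definition valid (P : formula) : Prop := forall s : state, holds P s.

Declare Scope term_scope.
Delimit Scope term_scope with term.
Bind Scope term_scope with term.
Coercion Var : var >-> term.
Notation "0" := (Const 0%R) : term_scope.
Notation "1" := (Const 1%R) : term_scope.
Notation "2" := (Const 2%R) : term_scope.
Notation "- e" := (Opp e) : term_scope.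
Infix "+" := Add : term_scope.
Infix "-" := Sub : term_scope.
Infix "*" := Mul : term_scope.
Infix "/" := Div : term_scope.
Notation "e ^ n" := (Pow e n%nat) : term_scope.

Declare Scope dl_scope.
Delimit Scope dl_scope with dl.
Bind Scope dl_scope with formula.
Bind Scope dl_scope with program.
Notation "e1 <= e2" := (Le e1%term e2%term) : dl_scope.
Notation "e1 >= e2" := (Le e2%term e1%term) (only parsing) : dl_scope.
Notation "e1 > e2" := (Lt e2%term e1%term) (only parsing) : dl_scope.
Infix "/\" := And : dl_scope.
Infix "->" := Imp : dl_scope.
Notation "y ::= e" := (Assign y e%term)
  (at level 75, no associativity) : dl_scope.
Notation "y ::= '*'" := (AssignAny y)
  (at level 75, no associativity) : dl_scope.
Notation "? P" := (Test P) (at level 76, right associativity) : dl_scope.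
Notation "a ;; b" := (Seq a b) (at level 81, right associativity) : dl_scope.

(** * The vehicle model *)

Definition msd (t : term) : term :=
  (v * t + a_n_max * t ^ 2 / 2
   + ((v + a_n_max * t) ^ 2 - v_c ^ 2) / (2 * a_s_min))%term.

Definition guarantee : formula :=
  (x >= x_c -> v <= v_c)%dl.

Definition plant : program :=
  (tau ::= 0 ;;
   ODE ((x, Var v) :: (v, Var a_s) :: (tau, Const 1) :: nil)
       (v >= 0 /\ tau <= T))%dl.

Definition ctrl : program :=
  If (x_c - x >= msd T)%dl
     (a_s ::= a_n)%dl
     (a_s ::= - a_s_min)%dl.

Definition env : program :=
  (x_c ::= * ;;
   v_c ::= * ;;
   ? (v_c >= 0 /\ x_c - x >= msd 0) ;;
   a_n ::= * ;;
   ? (- a_n_min <= a_n /\ a_n <= a_n_max))%dl.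

Definition init : formula :=
  (a_s_min > 0 /\ a_n_max > 0 /\ a_n_min > 0 /\ T > 0 /\
   v >= 0 /\ v_c >= 0 /\ x_c - x >= msd 0)%dl.

(* Main.v *)
(** Within one run of the plant the acceleration is constant, so the motion is
    [v t = v0 + a t], [x t = x0 + v0 t + a t^2 / 2].  Under braking,
    [x_c - x - msd 0] is conserved along the motion; under the nominal
    acceleration, [msd T] bounds [x t - x0 + msd 0] for every [t <= T].  Either
    way [x_c - x >= msd 0] holds after the plant, and this says that
    [v^2 <= v_c^2] as soon as [x >= x_c].  The test in [env] re-establishes
    [x_c - x >= msd 0] at each iteration, so it need not be part of the loop
    invariant. *)

From Stdlib Require Import Reals Lra List Relation_Operators.
Require Import Defs.
Open Scope R_scope.

(** * Integrating one-sided derivatives on a closed interval, and the resulting flow of the plant *)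

Definition clamp (d u : R) : R := Rmax 0 (Rmin d u).

Lemma clamp_id (d u : R) : 0 <= u <= d -> clamp d u = u.
Proof. intros; unfold clamp; rewrite Rmin_right, Rmax_right; lra. Qed.

Lemma clamp_bounds (d u : R) : 0 <= d -> 0 <= clamp d u <= d.
Proof. intros; unfold clamp, Rmax, Rmin; repeat destruct Rle_dec; lra. Qed.

Lemma clamp_lipschitz (d u w : R) :
  0 <= d -> Rabs (clamp d u - clamp d w) <= Rabs (u - w).
Proof.
  intros; unfold clamp, Rmax, Rmin, Rabs;
    repeat destruct Rle_dec; repeat destruct Rcase_abs; lra.
Qed.

(** Clamping fixes [t] and is 1-Lipschitz, so the [delta] of the relative limit serves unchanged for
    the two-sided one. *)
Lemma continue_in_clamp (f : R -> R) (d t : R) :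
  0 <= t <= d -> continue_in f (fun u => 0 <= u <= d) t ->
  continuity_pt (fun u => f (clamp d u)) t.
Proof.
  intros Ht Hf eps Heps.
  destruct (Hf eps Heps) as [delta [Hdelta Hlim]].
  exists delta; split; [exact Hdelta|].
  intros u [_ Hu]; simpl in *; unfold Rdist in *.
  rewrite (clamp_id d t Ht).
  (* The relative limit is punctured at [t], yet [clamp] may send another point [u] onto [t], for
     instance when [t] is an end point. *)
  destruct (Req_dec t (clamp d u)) as [<-|Hne].
  - rewrite Rminus_diag, Rabs_R0; exact Heps.
  - apply Hlim; split; [split; [apply clamp_bounds; lra|exact Hne]|].
    rewrite <- (clamp_id d t Ht) at 1.
    eapply Rle_lt_trans; [apply clamp_lipschitz; lra|exact Hu].
Qed.

Lemma D_in_derivable_clamp (f f' : R -> R) (d t : R) :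
  0 < t < d -> D_in f f' (fun u => 0 <= u <= d) t ->
  derivable_pt_lim (fun u => f (clamp d u)) t (f' t).
Proof.
  intros Ht Hf eps Heps.
  destruct (Hf eps Heps) as [delta [Hdelta Hlim]].
  (* This radius keeps [t + h] inside [[0, d]], where [clamp] is the identity. *)
  assert (Hpos : 0 < Rmin delta (Rmin t (d - t)))
    by (repeat apply Rmin_glb_lt; lra).
  exists (mkposreal _ Hpos); simpl; intros h Hh Hsmall.
  apply Rmin_Rgt_l in Hsmall as [Hsmall [Ht1 Ht2]%Rmin_Rgt_l].
  pose proof (Rle_abs h); pose proof (Rle_abs (- h)).
  rewrite Rabs_Ropp in *.
  rewrite !clamp_id by lra.
  specialize (Hlim (t + h)); simpl in Hlim; unfold Rdist in Hlim.
  replace (t + h - t) with h in Hlim by ring.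
  apply Hlim; split; [split; lra|lra].
Qed.

(* [D_in] is one-sided at the end points, so the mean value theorem is applied
   to the extension of [f] that is constant outside [[0, d]]. *)
Lemma D_in_zero_constant (f : R -> R) (d : R) :
  0 <= d ->
  (forall t, 0 <= t <= d ->
     D_in f (fun _ => 0) (fun u => 0 <= u <= d) t) ->
  f d = f 0.
Proof.
  intros [Hd|<-] Hf; [|reflexivity].
  set (g := fun u => f (clamp d u)).
  assert (Hg : forall t, 0 < t < d -> derivable_pt_lim g t 0).
  { intros t Ht; apply (D_in_derivable_clamp f (fun _ => 0)); [lra|].
    apply Hf; lra. }
  assert (pr1 : forall t, 0 < t < d -> derivable_pt g t)
    by (intros t Ht; exists 0; apply Hg, Ht).
  destruct (MVT g id 0 d pr1 (fun t _ => derivable_pt_id t) Hd)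
    as [t [Ht Heq]].
  - intros t Ht; apply continue_in_clamp; [lra|].
    apply (cont_deriv f (fun _ => 0)), Hf; lra.
  - intros; apply derivable_continuous_pt, derivable_pt_id.
  - rewrite derive_pt_id in Heq.
    rewrite (derive_pt_eq_0 _ _ _ (pr1 t Ht) (Hg t Ht)) in Heq.
    unfold g, id in Heq; rewrite !clamp_id in Heq by lra; lra.
Qed.

(** Subtracting the quadratic [p], which has the same derivative, leaves a function with zero
    derivative. *)
Lemma D_in_affine_solution (f : R -> R) (b c d : R) :
  0 <= d ->
  (forall t, 0 <= t <= d ->
     D_in f (fun u => b + c * u) (fun u => 0 <= u <= d) t) ->
  f d = f 0 + b * d + c * d ^ 2 / 2.
Proof.
  intros Hd Hf.
  pose (p := fun u => b * u + c / 2 * (u * u)).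
  enough (H : f d - p d = f 0 - p 0) by (unfold p in H; lra).
  apply (D_in_zero_constant (fun u => f u - p u)); [exact Hd|].
  intros t Ht.
  set (D := fun u => 0 <= u <= d).
  assert (Hp : D_in p (fun u => b + c * u) D t).
  { unfold p.
    eapply D_in_ext; [|apply Dadd;
      [apply Dmult_const, Dx
      |apply Dmult_const, Dmult; apply Dx]].
    simpl; field. }
  eapply D_in_ext; [|apply Dminus; [apply Hf, Ht|exact Hp]].
  simpl; ring.
Qed.

(** The clock [tau] starts at 0 with slope 1, so it equals the duration, and the domain constraint
    bounds that by [T]. Velocity is integrated before position because it is the derivative of
    position. *)
Lemma plant_flow (s s' : state) :
  reach plant s s' ->
  exists t, 0 <= t <= s T /\ 0 <= s' v /\
    s' v = s v + s a_s * t /\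
    s' x = s x + s v * t + s a_s * t ^ 2 / 2 /\
    (forall y, ~ In y (x :: v :: tau :: nil) -> s' y = s y).
Proof.
  intros [s0 [Hs0 (d & phi & Hd & Hphi0 & Hphid & [Hode Hfix] & Hdom)]].
  simpl in Hs0.
  assert (Hother : forall t, 0 <= t <= d ->
            forall y, ~ In y (x :: v :: tau :: nil) -> phi t y = s y).
  { intros t Ht y Hy; rewrite (Hfix y Hy t Ht), Hphi0, Hs0.
    unfold update; destruct var_eq_dec as [->|]; [|reflexivity].
    simpl in Hy; tauto. }
  assert (Hv : forall t, 0 <= t <= d -> phi t v = s v + s a_s * t).
  { intros t Ht.
    replace (s v) with (phi 0 v) by (rewrite Hphi0, Hs0; reflexivity).
    rewrite (D_in_affine_solution (fun u => phi u v) (s a_s) 0 t); [lra|lra|].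
    intros u Hu.
    (* The velocity is needed at every intermediate time, so the derivative is restricted from
       [[0, d]] to [[0, t]]. *)
    apply D_in_imp with (D := fun u => 0 <= u <= d); [intros; lra|].
    eapply D_in_ext; [|apply (Hode v (Var a_s)); [simpl; tauto|lra]].
    simpl; rewrite Hother by (simpl; intuition (discriminate || lra)); lra. }
  assert (Hx : phi d x = s x + s v * d + s a_s * d ^ 2 / 2).
  { replace (s x) with (phi 0 x) by (rewrite Hphi0, Hs0; reflexivity).
    apply (D_in_affine_solution (fun u => phi u x)); [exact Hd|].
    intros u Hu.
    eapply D_in_ext; [|apply (Hode x (Var v)); [simpl; tauto|lra]].
    simpl; apply Hv, Hu. }
  assert (Htau : phi d tau = d).
  { rewrite (D_in_affine_solution (fun u => phi u tau) 1 0 d Hd).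
    - rewrite Hphi0, Hs0; unfold update; simpl; lra.
    - intros u Hu.
      eapply D_in_ext; [|apply (Hode tau (Const 1)); [simpl; tauto|lra]].
      simpl; ring. }
  destruct (Hdom d ltac:(lra)) as [Hvd HTd]; simpl in Hvd, HTd.
  rewrite (Hother d ltac:(lra) T), Htau in HTd
    by (simpl; intuition discriminate).
  exists d; rewrite <- Hphid; repeat split; auto.
  - apply Hv; lra.
  - apply Hother; lra.
Qed.

(** * Real inequalities for the stopping distance *)

Lemma msd0_safe (b X V Xc Vc : R) :
  0 < b -> 0 <= Vc -> (V ^ 2 - Vc ^ 2) / (2 * b) <= Xc - X ->
  Xc <= X -> V <= Vc.
Proof.
  intros Hb HVc Hmsd HX.
  assert (Hsq : V ^ 2 - Vc ^ 2 <= 0).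
  { replace (V ^ 2 - Vc ^ 2) with ((V ^ 2 - Vc ^ 2) / (2 * b) * (2 * b))
      by (field; lra).
    rewrite <- (Rmult_0_l (2 * b)); apply Rmult_le_compat_r; lra. }
  nra.
Qed.

Lemma brake_msd0 (b X V Xc Vc t : R) :
  0 < b -> (V ^ 2 - Vc ^ 2) / (2 * b) <= Xc - X ->
  ((V + - b * t) ^ 2 - Vc ^ 2) / (2 * b)
    <= Xc - (X + V * t + - b * t ^ 2 / 2).
Proof.
  intros Hb Hmsd.
  replace (((V + - b * t) ^ 2 - Vc ^ 2) / (2 * b))
    with ((V ^ 2 - Vc ^ 2) / (2 * b) - V * t + b * t ^ 2 / 2) by (field; lra).
  lra.
Qed.

(** Each of the three summands of the distance at time [T] dominates its counterpart for
    acceleration [a] at time [t], whatever the sign of [a]. *)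
Lemma nominal_msd0 (b A a X V Xc Vc t T : R) :
  0 < b -> 0 < A -> a <= A -> 0 <= t <= T -> 0 <= V -> 0 <= V + a * t ->
  V * T + A * T ^ 2 / 2 + ((V + A * T) ^ 2 - Vc ^ 2) / (2 * b) <= Xc - X ->
  ((V + a * t) ^ 2 - Vc ^ 2) / (2 * b) <= Xc - (X + V * t + a * t ^ 2 / 2).
Proof.
  intros Hb HA Ha Ht HV HVt Hmsd.
  assert (Hat : a * t <= A * T).
  { apply Rle_trans with (A * t);
      [apply Rmult_le_compat_r|apply Rmult_le_compat_l]; lra. }
  assert (Hsq : ((V + a * t) ^ 2 - Vc ^ 2) / (2 * b)
                <= ((V + A * T) ^ 2 - Vc ^ 2) / (2 * b)).
  { apply Rmult_le_compat_r; [left; apply Rinv_0_lt_compat; lra|].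
    (* Squaring preserves the order because [V + a * t] is nonnegative. *)
    apply Rplus_le_compat_r, pow_incr; lra. }
  assert (HVT : V * t <= V * T) by (apply Rmult_le_compat_l; lra).
  assert (Hat2 : a * t ^ 2 <= A * T ^ 2).
  { apply Rle_trans with (A * t ^ 2).
    - apply Rmult_le_compat_r; [apply pow2_ge_0|exact Ha].
    - apply Rmult_le_compat_l; [lra|apply pow_incr; lra]. }
  lra.
Qed.

Lemma msd0_guarantee (s : state) :
  0 < s a_s_min -> 0 <= s v_c ->
  (s v ^ 2 - s v_c ^ 2) / (2 * s a_s_min) <= s x_c - s x ->
  holds guarantee s.
Proof. simpl; intros; eapply msd0_safe; eauto. Qed.

Lemma eval_msd0 (s : state) :
  eval s (msd (Const 0)) = (s v ^ 2 - s v_c ^ 2) / (2 * s a_s_min).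
Proof.
  simpl; rewrite !Rmult_0_l, !Rmult_0_r, Rplus_0_r.
  unfold Rdiv at 1; rewrite Rmult_0_l, !Rplus_0_l; reflexivity.
Qed.

(** * The loop invariant and its preservation *)

Definition invariant (s : state) : Prop :=
  0 < s a_s_min /\ 0 < s a_n_max /\ 0 <= s v /\ holds guarantee s.

Lemma env_spec (s s' : state) :
  reach env s s' ->
  s' a_s_min = s a_s_min /\ s' a_n_max = s a_n_max /\ s' v = s v /\
  0 <= s' v_c /\ s' a_n <= s' a_n_max /\
  (s' v ^ 2 - s' v_c ^ 2) / (2 * s' a_s_min) <= s' x_c - s' x.
Proof.
  intros (s1 & [r1 ->] & s2 & [r2 ->] & s3 & [-> [Hvc Hmsd]]
          & s4 & [r3 ->] & -> & [_ Han]).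
  cbn [holds] in Hmsd; rewrite eval_msd0 in Hmsd.
  repeat split; assumption.
Qed.

Lemma ctrl_plant_invariant (s s' : state) :
  0 < s a_s_min -> 0 < s a_n_max -> 0 <= s v -> 0 <= s v_c ->
  s a_n <= s a_n_max ->
  (s v ^ 2 - s v_c ^ 2) / (2 * s a_s_min) <= s x_c - s x ->
  reach (Seq ctrl plant) s s' ->
  invariant s'.
Proof.
  intros Hb HA HV HVc Han Hmsd [s1 [Hctrl Hplant]].
  apply plant_flow in Hplant as (t & Ht & HV' & Hv & Hx & Hother).
  assert (Hframe : forall y, y <> a_s -> s1 y = s y).
  { intros y Hy.
    destruct Hctrl as [(s0 & [-> _] & ->)|(s0 & [-> _] & ->)];
      unfold update; destruct var_eq_dec; congruence. }
  (* Only the value of [a_s] in [s1] depends on the branch taken by [ctrl], so the case split can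
     wait until the final inequality. *)
  rewrite !(Hframe v), ?(Hframe x), ?(Hframe T) in * by discriminate.
  assert (Hparam : forall y, ~ In y (a_s :: x :: v :: tau :: nil) ->
                     s' y = s y).
  { intros y Hy; rewrite Hother, Hframe; simpl in *;
      [reflexivity|intros ->; tauto|tauto]. }
  assert (Hb' := Hparam a_s_min ltac:(simpl; intuition discriminate)).
  assert (HA' := Hparam a_n_max ltac:(simpl; intuition discriminate)).
  assert (Hvc' := Hparam v_c ltac:(simpl; intuition discriminate)).
  assert (Hxc' := Hparam x_c ltac:(simpl; intuition discriminate)).
  repeat split; [lra|lra|exact HV'|].
  apply msd0_guarantee; [lra|lra|].
  rewrite Hb', Hvc', Hxc', Hx, Hv.
  rewrite Hv in HV'.
  destruct Hctrl as [(s0 & [-> Htest] & ->)|(s0 & [-> _] & ->)].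
  - apply nominal_msd0 with (A := s a_n_max) (T := s T); assumption.
  - apply brake_msd0; assumption.
Qed.

Lemma invariant_step (s s' : state) :
  invariant s -> reach (Seq env (Seq ctrl plant)) s s' -> invariant s'.
Proof.
  intros (Hb & HA & HV & _) [s1 [Henv Hrest]].
  apply env_spec in Henv as (Eb & EA & EV & HVc & Han & Hmsd).
  apply (ctrl_plant_invariant s1); auto; lra.
Qed.

Theorem theorem2 :
  valid (Imp init (Box (Star (Seq env (Seq ctrl plant))) guarantee)).
Proof.
  intros s (Hb & HA & _ & _ & HV & HVc & Hmsd) s' Hstar.
  assert (Hinv : invariant s).
  { repeat split; [exact Hb|exact HA|exact HV|].
    cbn [holds] in Hmsd; rewrite eval_msd0 in Hmsd.
    apply msd0_guarantee; assumption. }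
  enough (H : invariant s') by apply H.
  (* The induction generalizes over [s]; with [Hinv] as the only other hypothesis on it, each
     induction hypothesis says that the invariant propagates, and these compose in the transitivity
     case. *)
  clear - Hinv Hstar.
  change (clos_refl_trans state (reach (Seq env (Seq ctrl plant))) s s')
    in Hstar.
  induction Hstar; eauto using invariant_step.
Qed.
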